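(* Let $G$ be a simple loony endgame with no 3-chains. Let $f$ be the number of 4-loops in $G$ and let $c=cv(G)$. (a) If $c\ge2$ or $G$ is empty then $v(G)=c$. Assume from now on that $G$ is non-empty. (b) If $c\le1$, $f=0$ and $c$ is odd then $v(G)=3$. (c) If $c\le1$, $f=0$ and $c$ is even then $v(G)\in\{2,4\}$ and $v(G)\equiv c\pmod 4$. (d) If $c\le1$ and $f\ge1$, let $K$ denote $G$ with all its 4-loops removed, and let $d$ be the unique integer with $0\le d\le7$ and $d\equiv v(K)\pmod 8$. If $f$ is odd then $v(G)=|4-d|$, and if $f$ is even then $v(G)=4-|4-d|$.
   Context: Game. A dots and boxes game (position) $G$ consists of a finite set of unclaimed boxes and a finite set of undrawn lines, each undrawn line bordering either exactly one box or exactly two distinct boxes, each box being bordered by at least one and at most four undrawn lines. Two players play. The player to move draws (removes) an undrawn line; every box none of whose bordering lines is still undrawn is then claimed by that player. If the move claims at least one box the same player must move again (if a line remains); otherwise the other player moves. Claiming a box when possible is not compulsory. The game ends when no line remains. Each player maximises (own boxes) minus (opponent's boxes), counting only boxes claimed from $G$ onwards. Value. $v(G)$ is the net score, under optimal play, of the player who is NOT to move in $G$. Equivalently, $v(G)=0$ if $G$ has no undrawn lines, and otherwise $v(G)=\min_m v(G;m)$ over undrawn lines $m$, where, if drawing $m$ claims $k$ boxes and leaves the position $G_m$, then $v(G;m)=v(G_m)-k$ if $k\ge1$ and $v(G;m)=-v(G_m)$ if $k=0$. Chains and loops. An $n$-chain has boxes $b_1,\dots,b_n$ and lines $e_0,\dots,e_n$,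 where $e_i$ borders $b_i,b_{i+1}$ for $1\le i\le n-1$, $e_0$ borders only $b_1$ and $e_n$ borders only $b_n$. An $n$-loop ($n\ge4$) has boxes $b_1,\dots,b_n$ and lines $e_1,\dots,e_n$, $e_i$ bordering $b_i,b_{i+1}$ (indices mod $n$). A simple loony endgame is a finite (possibly empty) disjoint union of chains of length at least 3 and loops of even length at least 4. Controlled value. If $G$ is a simple loony endgame with chains of lengths $c_i$ and loops of lengths $\ell_j$, then $fcv(G)=\sum_i(c_i-4)+\sum_j(\ell_j-8)$ and $cv(G)=fcv(G)+tb(G)$, where the terminal bonus $tb(G)$ is: $0$ if $G$ is empty; $4$ if $G$ is non-empty and has a chain of length at least 4 or has no loops; $8$ if $G$ has loops but no chains; $6$ if $G$ has both chains and loops and all its chains are 3-chains. *)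

(* Defs.v *)
From mathcomp Require Import all_boot all_order all_algebra.

Set Implicit Arguments.
Unset Strict Implicit.
Unset Printing Implicit Defensive.

Import Order.TTheory GRing.Theory Num.Theory.
Local Open Scope ring_scope.

Record game := Game {
  box : finType;
  line : finType;
  border : line -> {set box} }.

Definition lines_at (G : game) (S : {set line G}) (b : box G) : {set line G} :=
  [set l in S | b \in border l].

Definition wf_game (G : game) : Prop :=
  (forall l : line G, (1 <= #|border l| <= 2)%N) /\
  (forall b : box G, (1 <= #|lines_at [set: line G] b| <= 4)%N).

(* The positions reachable from [G] are given by the set [S] of undrawn lines;
   the unclaimed boxes are those bordered by a line of [S]. *)
Definition claimed (G : game) (S : {set line G}) (m : line G) : nat :=
  #|[set b | lines_at S b == [set m]]|.

(* [n] is fuel: the recursion removes one line at a time, so [n = #|S|] is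
   enough.  In the minimum, [m0] only serves to provide a default value that is
   one of the values minimised over. *)
Fixpoint value_rec (G : game) (n : nat) (S : {set line G}) : int :=
  if n isn't n'.+1 then 0 else
  let mv m :=
    let k := claimed S m in
    let w := value_rec n' (S :\ m) in
    if (0 < k)%N then w - k%:Z else - w in
  if [pick m in S] is Some m0 then \big[Order.min/mv m0]_(m in S) mv m else 0.

Definition value (G : game) (S : {set line G}) : int := value_rec #|S| S.

Definition move_value (G : game) (S : {set line G}) (m : line G) : int :=
  let k := claimed S m in
  if (0 < k)%N then value (S :\ m) - k%:Z else - value (S :\ m).

Definition v (G : game) : int := value [set: line G].

Lemma value0 (G : game) : value (set0 : {set line G}) = 0.
Proof. by rewrite /value cards0. Qed.

Lemma value_min (G : game) (S : {set line G}) : S != set0 ->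
  (exists2 m, m \in S & value S = move_value S m) /\
  (forall m, m \in S -> value S <= move_value S m).
Proof.
move=> S0; have [m0 m0S] := set0Pn _ S0.
have [n cS] : exists n, #|S| = n.+1.
  by exists #|S|.-1; rewrite prednK // card_gt0.
have mvE m : m \in S ->
  (let k := claimed S m in let w := value_rec n (S :\ m) in
   if (0 < k)%N then w - k%:Z else - w) = move_value S m.
  move=> mS; suff -> : n = #|S :\ m| by [].
  by move: cS; rewrite (cardsD1 m) mS => -[].
rewrite /value cS /=; case: pickP => [m1 m1S|/(_ m0)]; last by rewrite m0S.
rewrite /= in mvE; rewrite mvE // (eq_bigr (move_value S)) //; split.
  apply: (big_ind (fun x => exists2 m, m \in S & x = move_value S m)).
  - by exists m1.
  - by move=> x y [a aS ->] [b bS ->]; case: leP => _; [exists a | exists b].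
  - by move=> m mS; exists m.
by move=> m mS; rewrite (bigD1 m) //= ge_min lexx.
Qed.

Definition empty_game : game := @Game void void (fun _ => set0).

Definition disjoint_union (G H : game) : game :=
  @Game (box G + box H)%type (line G + line H)%type
    (fun l => match l with
              | inl l => inl @: border l
              | inr l => inr @: border l
              end).

(* Boxes are numbered from 0, so that box [b] lies between lines [b], [b.+1]. *)
Definition chain (n : nat) : game :=
  @Game 'I_n 'I_n.+1 (fun e => [set b : 'I_n | (e == b :> nat) || (e == b.+1 :> nat)]).

(* [ordS e] is the successor of [e] modulo [n]. *)
Definition loop (n : nat) : game :=
  @Game 'I_n 'I_n (fun e => [set e; ordS e]).

Record endgame := Endgame { chains : seq nat; loops : seq nat }.

Definition simple_loony (G : endgame) : bool :=
  all (fun n => 3 <= n)%N (chains G) &&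
  all (fun n => (4 <= n)%N && ~~ odd n) (loops G).

Definition game_of (G : endgame) : game :=
  foldr disjoint_union empty_game (map chain (chains G) ++ map loop (loops G)).
Coercion game_of : endgame >-> game.

Definition is_empty (G : endgame) : bool := nilp (chains G) && nilp (loops G).

Definition fcv (G : endgame) : int :=
  \sum_(n <- chains G) (n%:Z - 4) + \sum_(n <- loops G) (n%:Z - 8).

(* The last case is that of loops together with chains that are all 3-chains. *)
Definition tb (G : endgame) : int :=
  if is_empty G then 0
  else if has (fun n => 4 <= n)%N (chains G) || nilp (loops G) then 4
  else if nilp (chains G) then 8
  else 6.

Definition cv (G : endgame) : int := fcv G + tb G.

Definition remove_4loops (G : endgame) : endgame :=
  Endgame (chains G) [seq n <- loops G | n != 4%N].

Lemma wf_disjoint_union (G H : game) :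
  wf_game G -> wf_game H -> wf_game (disjoint_union G H).
Proof.
have inlI (A B : finType) : injective (@inl A B) by move=> x y [].
have inrI (A B : finType) : injective (@inr A B) by move=> x y [].
move=> [lG bG] [lH bH]; split=> [[l|l]|[b|b]] /=.
- by rewrite (card_imset _ (inlI _ _)).
- by rewrite (card_imset _ (inrI _ _)).
- rewrite (_ : lines_at _ _ =
    [set (inl x : line (disjoint_union G H)) | x in lines_at [set: line G] b]).
    by rewrite (card_imset _ (inlI _ _)).
  apply/setP => -[l|l]; rewrite !inE /=.
    by rewrite !(mem_imset _ _ (inlI _ _)) !inE.
  by apply/imsetP/imsetP => -[].
rewrite (_ : lines_at _ _ =
    [set (inr x : line (disjoint_union G H)) | x in lines_at [set: line H] b]).
  by rewrite (card_imset _ (inrI _ _)).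
apply/setP => -[l|l]; rewrite !inE /=.
  by apply/imsetP/imsetP => -[].
by rewrite !(mem_imset _ _ (inrI _ _)) !inE.
Qed.

Lemma wf_chain (n : nat) : (0 < n)%N -> wf_game (chain n).
Proof.
case: n => // n _; split=> [e|b] /=.
  apply/andP; split.
    rewrite card_gt0; apply/set0Pn; case: (ltnP e n.+1) => en.
      by exists (Ordinal en); rewrite inE eqxx.
    exists ord_max; rewrite inE /= [X in _ || X]eqn_leq en orbC.
    by rewrite -ltnS ltn_ord.
  apply: (@leq_trans #|[set inord e; inord e.-1] : {set 'I_n.+1}|).
    apply/subset_leq_card/subsetP => b; rewrite !inE => /orP[]/eqP ->.
      by rewrite inord_val eqxx.
    by rewrite /= inord_val eqxx orbT.
  by rewrite cards2; case: (_ != _).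
rewrite (_ : lines_at _ _ = [set (inord b : line (chain n.+1)); inord b.+1]).
  by rewrite cards2; case: (_ != _).
have bn : (b <= n)%N := ltn_ord b.
by apply/setP => e; rewrite !inE /= -!val_eqE /= !inordK // ltnS // ltnW.
Qed.

Lemma wf_loop (n : nat) : wf_game (loop n).
Proof.
split=> [e|b] /=; first by rewrite cards2; case: (_ != _).
rewrite (_ : lines_at _ _ = [set (b : line (loop n)); ord_pred b]).
  by rewrite cards2; case: (_ != _).
apply/setP => e; rewrite !inE /= eq_sym; congr (_ || _).
by apply/eqP/eqP => ->; rewrite ?ordSK ?ord_predK.
Qed.

Lemma wf_endgame (G : endgame) : simple_loony G -> wf_game G.
Proof.
case: G => cs ls /andP[/= hc _]; rewrite /game_of /=.
elim: cs hc => [_|c cs IH /= /andP[c3 /IH]].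
  by elim: ls => [|l ls IH] /=; [split; case | exact: wf_disjoint_union (wf_loop l) IH].
by apply/wf_disjoint_union/wf_chain/(leq_trans _ c3).
Qed.

(* Main.v *)
Require Import Defs.
From mathcomp Require Import all_boot all_order all_algebra.
From mathcomp Require Import zify.

Import Order.TTheory GRing.Theory Num.Theory.
Local Open Scope ring_scope.

(** Opening a chain of length [n] lets the opponent either take all its boxes
and move in the rest [H], or hand the last two boxes back and keep control;
hence it is worth [n - 2 + |v(H) - 2|], and likewise [n - 4 + |v(H) - 4|] for a
loop, and [v(G)] is the minimum over the components.  To obtain this from the
game played line by line, the value of every reachable position is computed by
induction: it only depends on the untouched components, the number of boxes
left in the touched ones, and the cheapest hand-out still available there.

Without 4-loops and 3-chains the recursion is solved, for nonempty [G], by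
[v = capped (cv)], where [capped c] is [c] if [c >= 2], and otherwise 3, 2 or 4
according to [c] modulo 4.  Opening a 4-loop replaces [x] by [|x - 4|], a
1-Lipschitz map; combined with the bounds of [loony_remove] this shows that
4-loops should be opened first, so [v(G)] is obtained by iterating [x |-> |x - 4|]
on [v(K)]. *)

(** * The recursion over whole components *)

(* The flag is true for a loop; the number is the length. *)
Definition component : Type := (bool * nat)%type.
Definition component_game (c : component) : game := if c.1 then loop c.2 else chain c.2.
Definition handout (c : component) : nat := (if c.1 then 4 else 2)%N.

Definition open_value (c : component) (x : int) : int :=
  c.2%:Z - (handout c)%:Z + `|x - (handout c)%:Z|.

(** As in [value_rec], [n] is fuel, exact when [n = size s], and the default of the minimum is one
    of the values minimised over. *)
Fixpoint loony_rec (n : nat) (s : seq component) : int :=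
  if n isn't n'.+1 then 0 else
  let mv c := open_value c (loony_rec n' (rem c s)) in
  if s is c0 :: _ then \big[Order.min/mv c0]_(c <- s) mv c else 0.

Definition loony (s : seq component) : int := loony_rec (size s) s.

Lemma big_min_eqs (I : eqType) (F : I -> int) (x : int) (s : seq I) :
  (x \in map F s -> \big[Order.min/x]_(i <- s) F i \in map F s) /\
  (forall i, i \in s -> \big[Order.min/x]_(j <- s) F j <= F i).
Proof.
split.
  move=> xs; rewrite big_seq; elim/big_ind: _ => // [a b|i si]; last exact: map_f.
  by move=> *; case: leP.
elim: s => //= a s IH i; rewrite inE big_cons ge_min => /predU1P[->|/IH ->].
  by rewrite lexx.
by rewrite orbT.
Qed.

Lemma loony_rec_min n s : size s = n.+1 ->
  (exists2 c, c \in s & loony_rec n.+1 s = open_value c (loony_rec n (rem c s))) /\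
  (forall c, c \in s -> loony_rec n.+1 s <= open_value c (loony_rec n (rem c s))).
Proof.
case: s => // c0 s _; set t := c0 :: s.
set F := fun c => open_value c (loony_rec n (rem c t)).
have [h1 h2] := @big_min_eqs _ F (F c0) t; split; last exact: h2.
have /h1/mapP[c ct e] : F c0 \in map F t by apply: map_f; rewrite mem_head.
by exists c.
Qed.

(** Play fixes the list of untouched components only up to permutation, hence this invariance; both
    sides minimise over the same components, with permuted remainders. *)
Lemma perm_loony_rec n s t : size s = n -> perm_eq s t -> loony_rec n s = loony_rec n t.
Proof.
elim: n s t => // n IH s t ss st.
have [[c cs es] hs] := @loony_rec_min n s ss.
have tt : size t = n.+1 by rewrite -(perm_size st).
have [[d dt et] ht] := @loony_rec_min n t tt.
have E x : x \in s -> loony_rec n (rem x s) = loony_rec n (rem x t).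
  move=> xs; apply: IH; first by rewrite size_rem // ss.
  rewrite -(perm_cons x); have xt : x \in t by rewrite -(perm_mem st).
  by rewrite -(permPl (perm_to_rem xs)) (permPl st) perm_to_rem.
apply/eqP; rewrite eq_le; apply/andP; split.
  by rewrite et -E ?(perm_mem st) //; apply: hs; rewrite (perm_mem st).
by rewrite es E //; apply: ht; rewrite -(perm_mem st).
Qed.

Lemma perm_loony s t : perm_eq s t -> loony s = loony t.
Proof. by move=> st; rewrite /loony -(perm_size st); exact: perm_loony_rec. Qed.

Lemma loony_min s : s != [::] ->
  (exists c t, perm_eq s (c :: t) /\ loony s = open_value c (loony t)) /\
  (forall c t, perm_eq s (c :: t) -> loony s <= open_value c (loony t)).
Proof.
case: s => // c0 s _; set u := c0 :: s; have su : size u = (size s).+1 by [].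
have [[c cu ec] hu] := @loony_rec_min _ _ su; rewrite -{1}su -/(loony u) in ec.
split.
  exists c, (rem c u); split; first exact: perm_to_rem.
  by rewrite ec /loony size_rem.
move=> d t ut; have du : d \in u by rewrite (perm_mem ut) mem_head.
apply: le_trans (hu d du) _; rewrite -[size s]/(size u).-1 -(size_rem du) -/(loony _).
rewrite (@perm_loony _ t) // -(perm_cons d) -(permPr ut) perm_sym.
exact: perm_to_rem.
Qed.

(** * Positions reached in line-by-line play *)

(* The level of a position measures its cheapest hand-out that keeps control:
   2 if two boxes suffice (a string of at least two capturable boxes ending at a
   line that borders only one box), 1 if four boxes are needed (a string of at
   least four boxes capturable from both ends), 0 if there is none. *)
Definition level (c : component) : nat := (if c.1 then 1 else 2)%N.
Definition handout_level (l : nat) : nat := (if l is 1 then 4 else 2)%N.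
Definition long (c : component) : bool := if c.1 then (4 <= c.2)%N else (3 <= c.2)%N.

(* [hs S] lists the untouched components of the position [S], [nb S] counts the
   unclaimed boxes of the touched ones, and [lv S] is their level. *)
Record described (G : game) (hs : {set line G} -> seq component)
    (nb lv : {set line G} -> nat) : Prop := Described {
  desc_long : forall S, all long (hs S);
  desc_level : forall S, (lv S <= 2)%N /\ ((0 < lv S)%N -> (handout_level (lv S) <= nb S)%N);
  desc_move : forall (S : {set line G}) m, m \in S ->
    (exists c, [/\ perm_eq (hs S) (c :: hs (S :\ m)), claimed S m = 0%N,
      nb (S :\ m) = (c.2 + nb S)%N & lv (S :\ m) = maxn (level c) (lv S)]) \/
    [/\ hs (S :\ m) = hs S, nb S = (claimed S m + nb (S :\ m))%N,
      (lv (S :\ m) <= lv S)%N & claimed S m = 0%N -> (0 < lv S)%N];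
  desc_open : forall (S : {set line G}) c, c \in hs S -> exists2 m, m \in S &
    [/\ perm_eq (hs S) (c :: hs (S :\ m)), claimed S m = 0%N,
      nb (S :\ m) = (c.2 + nb S)%N & lv (S :\ m) = maxn (level c) (lv S)];
  desc_take : forall S : {set line G}, (0 < nb S)%N -> exists2 m, m \in S & (0 < claimed S m)%N;
  desc_keep : forall S : {set line G}, (0 < lv S)%N ->
    (exists m, [/\ m \in S, (0 < claimed S m)%N & lv (S :\ m) = lv S]) \/
    (nb S = handout_level (lv S) /\
     exists m, [/\ m \in S, claimed S m = 0%N, hs (S :\ m) = hs S & lv (S :\ m) = 0%N]) }.

(* The score of the player to move when [x] is the value of the untouched part:
   either take all [N] boxes, or hand back the last [handout_level l] of them. *)
Definition controlled (N l : nat) (x : int) : int :=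
  N%:Z + (if l is 0 then - x else Order.max (- x) (x - (2 * handout_level l)%N%:Z)).

(** By induction on the number of undrawn lines. A player facing capturable boxes either takes them
    all and moves in the untouched part, or keeps control by a hand-out; the fields of [described]
    make these options available and show that no other move does better. *)
Lemma value_described (G : game) hs nb lv : @described G hs nb lv ->
  forall S, value S = - controlled (nb S) (lv S) (loony (hs S)).
Proof.
case=> dlong dlevel dmove dopen dtake dkeep S.
have [n] := ubnP #|S|; elim: n => // n IH in S *; rewrite ltnS => Sn.
have IHm m : m \in S -> value (S :\ m) =
    - controlled (nb (S :\ m)) (lv (S :\ m)) (loony (hs (S :\ m))).
  by move=> mS; apply: IH; move: Sn; rewrite (cardsD1 m) mS.
have [S0|S0] := eqVneq S set0.
  have h0 : hs S = [::].
    case E: (hs S) => [//|c t]; have [|m] := dopen S c; [by rewrite E mem_head|].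
    by rewrite S0 inE.
  have n0 : nb S = 0%N.
    by case: (posnP (nb S)) => // /dtake [m]; rewrite S0 inE.
  have l0 : lv S = 0%N.
    case: (posnP (lv S)) => // l; have [_ /(_ l)] := dlevel S; rewrite n0.
    by case: (lv S) => [|[|]].
  by rewrite h0 n0 l0 S0 value0.
have [[m0 m0S e0] hmin] := value_min S0.
have [lv2 lvn] := dlevel S.
have long_hs c t : perm_eq (hs S) (c :: t) -> long c.
  by move=> /perm_mem p; apply: (allP (dlong S)); rewrite p mem_head.
have mvopen m c : m \in S ->
    [/\ perm_eq (hs S) (c :: hs (S :\ m)), claimed S m = 0%N,
      nb (S :\ m) = (c.2 + nb S)%N & lv (S :\ m) = maxn (level c) (lv S)] ->
    move_value S m = controlled (c.2 + nb S) (maxn (level c) (lv S)) (loony (hs (S :\ m))).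
  by move=> mS [_ k0 en el]; rewrite /move_value k0 ltnn IHm // en el opprK.
have mvtake m : m \in S -> (0 < claimed S m)%N -> [/\ hs (S :\ m) = hs S,
   nb S = (claimed S m + nb (S :\ m))%N, (lv (S :\ m) <= lv S)%N &
   move_value S m = - controlled (nb S) (lv (S :\ m)) (loony (hs S))].
  move=> mS k0; case: (dmove S m mS) => [[c [_ k _ _]]|[eh en el _]].
    by rewrite k in k0.
  by split=> //; rewrite /move_value k0 IHm // eh /controlled [in RHS]en; lia.
(* With no touched box left the level is 0 and every move opens a component, so this minimum agrees
   with that of [loony_min]. *)
case: (posnP (nb S)) => N0.
  have l0 : lv S = 0%N.
    case: (posnP (lv S)) => // l; move: (lvn l); rewrite N0.
    by case: (lv S) => [|[|]].
  have op m : m \in S -> exists c, perm_eq (hs S) (c :: hs (S :\ m)) /\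
      move_value S m = open_value c (loony (hs (S :\ m))).
    move=> mS; case: (dmove S m mS) => [[c h]|[_]]; last first.
      by rewrite N0 l0 => /esym/eqP; rewrite addn_eq0 => /andP[/eqP -> _] _ /(_ erefl).
    exists c; split; first by case: h.
    rewrite (mvopen m c mS h) N0 l0 maxn0 /controlled /open_value /handout /level.
    by case: (c.1) => /=; lia.
  have hsn : hs S != [::].
    by have [c [p _]] := op m0 m0S; apply/eqP => E; have := perm_size p; rewrite E.
  rewrite /controlled N0 l0 add0r opprK; have [[c [t [p e]]] hle] := loony_min _ hsn.
  apply/eqP; rewrite eq_le; apply/andP; split.
    have [|m mS h] := dopen S c; first by rewrite (perm_mem p) mem_head.
    apply: le_trans (hmin m mS) _; rewrite (mvopen m c mS h) e N0 l0 maxn0.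
    rewrite (@perm_loony _ t); last first.
      by case: h => q _ _ _; rewrite -(perm_cons c) -(permPl q).
    rewrite /controlled /open_value /handout /level.
    by case: (c.1) => /=; lia.
  by have [c' [p' e']] := op m0 m0S; rewrite e0 e'; apply: hle.
(* Lower bound, over all moves. A capture never raises the level; a move in the touched part without
   capture offers the opponent at least [handout_level (lv S)] boxes; an opening offers the touched
   boxes as well and is bounded through [loony_min]. *)
apply/eqP; rewrite eq_le; apply/andP; split; last first.
  rewrite e0; case: (dmove S m0 m0S) => [[c h]|[eh en el kl]]; last first.
    have [k0|k0] := posnP (claimed S m0).
      have l0 := kl k0; rewrite /move_value k0 ltnn IHm // eh.
      have en' : nb (S :\ m0) = nb S by rewrite en k0.
      move: lv2 l0 (lvn l0) el; rewrite en' /controlled.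
      by case: (lv S) => [|[|[|]]] //; case: (lv (S :\ m0)) => [|[|[|]]] //=; lia.
    have [_ _ _ ->] := mvtake _ m0S k0; move: lv2 el; rewrite /controlled.
    by case: (lv S) => [|[|[|]]] //; case: (lv (S :\ m0)) => [|[|[|]]] //=; lia.
  rewrite (mvopen _ c m0S h); have [p _ _ _] := h.
  have hsn : hs S != [::] by apply/eqP => E; have := perm_size p; rewrite E.
  have [_ /(_ c _ p)] := loony_min _ hsn; have := long_hs _ _ p.
  move: (loony _) (loony _) lv2 lvn {h p} => x y; rewrite /controlled /open_value.
  case: c => [[] k]; rewrite /long /level /handout /=;
  by case: (lv S) => [|[|[|]]] //=; lia.
(* Upper bound. Any capture achieves at least the option of taking everything. When control is
   possible, the other option comes from a capture that preserves the level or, when just the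
   hand-out remains, from offering it. *)
have [m1 m1S k1] := dtake S N0; have [_ _ l1 e1] := mvtake _ m1S k1.
have := hmin _ m1S; rewrite e1 => h1.
have [l0|l0] := posnP (lv S).
  by move: l1 h1; rewrite l0 leqn0 => /eqP ->.
case: (dkeep S l0) => [[m [mS k em]]|[en [m [mS k eh em]]]].
  by have := hmin _ mS; have [_ _ _ ->] := mvtake _ mS k; rewrite em.
have en' : nb (S :\ m) = nb S.
  case: (dmove S m mS) => [[c [p _ _ _]]|[_ -> _ _]]; last by rewrite k.
  by have := perm_size p; rewrite eh /=; lia.
have := hmin _ mS; rewrite /move_value k ltnn IHm // eh em en' opprK.
move: lv2 l0 h1 en l1; rewrite /controlled.
by case: (lv S) => [|[|[|]]] //; case: (lv (S :\ m1)) => [|[|[|]]] //=; lia.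
Qed.

(** * Disjoint unions *)

Section Union.
Context (G H : game).
Implicit Type S : {set line (disjoint_union G H)}.

Definition lpart S : {set line G} := [set l | inl l \in S].
Definition rpart S : {set line H} := [set l | inr l \in S].

Lemma lpartD1l S l : lpart (S :\ inl l) = lpart S :\ l.
Proof. by apply/setP => k; rewrite !inE. Qed.

Lemma lpartD1r S l : lpart (S :\ inr l) = lpart S.
Proof. by apply/setP => k; rewrite !inE. Qed.

Lemma rpartD1l S l : rpart (S :\ inl l) = rpart S.
Proof. by apply/setP => k; rewrite !inE. Qed.

Lemma rpartD1r S l : rpart (S :\ inr l) = rpart S :\ l.
Proof. by apply/setP => k; rewrite !inE. Qed.

Lemma claimed_inl S l : claimed S (inl l : line (disjoint_union G H)) = claimed (lpart S) l.
Proof.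
have inj : injective (@inl (box G) (box H)) by move=> x y [].
rewrite /claimed -(card_imset _ inj); apply: eq_card => -[b|b]; rewrite inE.
  rewrite mem_imset // inE; apply/eqP/eqP => /setP e; apply/setP.
    by move=> k; have := e (inl k); rewrite !inE /= mem_imset.
  move=> [k|k]; first by have := e k; rewrite !inE /= mem_imset.
  by rewrite !inE /=; apply/andP => -[_ /imsetP[]].
have -> : (inr b \in [set inl x | x in [set b0 | lines_at (lpart S) b0 == [set l]]]) = false.
  by apply/imsetP => -[].
apply/eqP => /setP/(_ (inl l)); rewrite !inE eqxx => /andP[_ /=].
by move=> /imsetP[].
Qed.

Lemma claimed_inr S l : claimed S (inr l : line (disjoint_union G H)) = claimed (rpart S) l.
Proof.
have injr : injective (@inr (box G) (box H)) by move=> x y [].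
rewrite /claimed -(card_imset _ injr); apply: eq_card => -[b|b]; rewrite inE; last first.
  rewrite mem_imset // inE; apply/eqP/eqP => /setP e; apply/setP.
    by move=> k; have := e (inr k); rewrite !inE /= mem_imset.
  move=> [k|k]; last by have := e k; rewrite !inE /= mem_imset.
  by rewrite !inE /=; apply/andP => -[_ /imsetP[]].
have -> : (inl b \in [set inr x | x in [set b0 | lines_at (rpart S) b0 == [set l]]]) = false.
  by apply/imsetP => -[].
apply/eqP => /setP/(_ (inr l)); rewrite !inE eqxx => /andP[_ /=].
by move=> /imsetP[].
Qed.

(** Levels combine by maximum because level 2 needs the smaller hand-out. For [desc_keep]: once the
    side of higher level holds just its hand-out, any touched box on the other side allows a capture
    there that leaves the maximum unchanged; if there is none, the hand-out is that of the union. *)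
Lemma described_union hs1 nb1 lv1 hs2 nb2 lv2 :
  @described G hs1 nb1 lv1 -> @described H hs2 nb2 lv2 ->
  @described (disjoint_union G H)
    (fun S => hs1 (lpart S) ++ hs2 (rpart S))
    (fun S => nb1 (lpart S) + nb2 (rpart S))%N
    (fun S => maxn (lv1 (lpart S)) (lv2 (rpart S))).
Proof.
move=> [long1 level1 move1 open1 take1 keep1] [long2 level2 move2 open2 take2 keep2].
pose simp := (lpartD1l, lpartD1r, rpartD1l, rpartD1r, claimed_inl, claimed_inr).
have handout_max a b : (a <= 2)%N -> (b <= 2)%N -> (0 < maxn a b)%N ->
    handout_level (maxn a b) =
    if (b <= a)%N then handout_level a else handout_level b.
  by move: a b => [|[|[]]] // [|[|[]]].
split.
- by move=> S; rewrite all_cat long1 long2.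
- move=> S; have [a1 b1] := level1 (lpart S); have [a2 b2] := level2 (rpart S).
  split=> [|l]; first by rewrite geq_max a1.
  by rewrite handout_max //; case: ifP; lia.
- move=> S [m|m] mS; rewrite !simp.
    have /move1 : m \in lpart S by rewrite inE.
    case=> [[c [p k en el]]|[e k el kl]]; [left | right].
      by exists c; split; [rewrite -cat_cons perm_cat2r | | lia | lia].
    by split; [rewrite e | lia | lia | move/kl; lia].
  have /move2 : m \in rpart S by rewrite inE.
  case=> [[c [p k en el]]|[e k el kl]]; [left | right].
    exists c; split; [| by [] | lia | lia].
    by rewrite -cat1s perm_sym perm_catCA perm_cat2l perm_sym.
  by split; [rewrite e | lia | lia | move/kl; lia].
- move=> S c; rewrite mem_cat => /orP[/open1|/open2] [m mS [p k en el]].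
    exists (inl m); first by rewrite inE in mS.
    by rewrite !simp; split; [rewrite -cat_cons perm_cat2r | | lia | lia].
  exists (inr m); first by rewrite inE in mS.
  rewrite !simp; split; [| by [] | lia | lia].
  by rewrite -cat1s perm_sym perm_catCA perm_cat2l perm_sym.
- move=> S; rewrite addn_gt0 => /orP[/take1|/take2] [m]; rewrite inE => mS k.
    by exists (inl m); rewrite ?simp.
  by exists (inr m); rewrite ?simp.
move=> S l0; have [a1 b1] := level1 (lpart S); have [a2 b2] := level2 (rpart S).
rewrite handout_max //; case: ifP => l21.
  have l1 : (0 < lv1 (lpart S))%N by lia.
  case: (keep1 _ l1) => [[m [mS k el]]|[en [m [mS k eh el]]]].
    by left; exists (inl m); rewrite !simp el; split=> //; rewrite inE in mS.
  have [n2|n2] := posnP (nb2 (rpart S)).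
    have l2 : lv2 (rpart S) = 0%N.
      by case: (posnP (lv2 (rpart S))) => // /b2; rewrite n2; case: (lv2 _) => [|[]].
    right; rewrite n2 addn0; split=> //; exists (inl m).
    by rewrite !simp eh el l2; split=> //; rewrite inE in mS.
  have [m' m'S k'] := take2 _ n2; left; exists (inr m'); rewrite !simp; split=> //.
    by rewrite inE in m'S.
  have := k'; case: (move2 _ _ m'S) => [[c [_ -> //]]|[_ _ el' _] _]; lia.
have l2 : (0 < lv2 (rpart S))%N by lia.
case: (keep2 _ l2) => [[m [mS k el]]|[en [m [mS k eh el]]]].
  by left; exists (inr m); rewrite !simp el; split=> //; rewrite inE in mS.
have [n1|n1] := posnP (nb1 (lpart S)).
  have l1 : lv1 (lpart S) = 0%N.
    by case: (posnP (lv1 (lpart S))) => // /b1; rewrite n1; case: (lv1 _) => [|[]].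
  right; rewrite n1 add0n; split=> //; exists (inr m).
  by rewrite !simp eh el l1; split=> //; rewrite inE in mS.
have [m' m'S k'] := take1 _ n1; left; exists (inl m'); rewrite !simp; split=> //.
  by rewrite inE in m'S.
by have := k'; case: (move1 _ _ m'S) => [[c [_ -> //]]|[_ _ el' _] _]; lia.
Qed.

End Union.

(** * Criterion for a single component *)

Lemma described_empty :
  @described empty_game (fun=> [::]) (fun=> 0%N) (fun=> 0%N).
Proof. by split=> // S []. Qed.

Definition unclaimed {G : game} (S : {set line G}) : {set box G} :=
  [set b | lines_at S b != set0].

Lemma card_unclaimedD1 (G : game) (S : {set line G}) m : m \in S ->
  #|unclaimed S| = (claimed S m + #|unclaimed (S :\ m)|)%N.
Proof.
move=> mS; rewrite -(cardsID [set b | lines_at S b == [set m]] (unclaimed S)).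
have E b : lines_at (S :\ m) b = lines_at S b :\ m.
  by apply/setP => l; rewrite !inE andbA.
congr (_ + _)%N; apply: eq_card => b; rewrite !inE.
  case: (lines_at S b =P [set m]) => [->|_]; rewrite ?andbF // andbT.
  by apply/set0Pn; exists m; rewrite inE.
by rewrite E setD_eq0 subset1 negb_or.
Qed.

(** An untouched component is one with all its lines undrawn, so [setT] is set apart in the
    description and [lvl] has to be meaningful only on the other positions. *)
Lemma described_unit (G : game) (c : component) (lvl : {set line G} -> nat) :
  long c -> (0 < #|line G|)%N ->
  (forall m, claimed [set: line G] m = 0%N) ->
  (forall m, #|unclaimed ([set: line G] :\ m)| = c.2) ->
  (forall m, lvl ([set: line G] :\ m) = level c) ->
  (forall S : {set line G}, (lvl S <= 2)%N) ->
  (forall S : {set line G}, S != setT -> (0 < lvl S)%N -> (handout_level (lvl S) <= #|unclaimed S|)%N) ->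
  (forall (S : {set line G}) m, S != setT -> m \in S -> (lvl (S :\ m) <= lvl S)%N) ->
  (forall (S : {set line G}) m, S != setT -> m \in S -> claimed S m = 0%N -> (0 < lvl S)%N) ->
  (forall S : {set line G}, S != setT -> S != set0 -> exists2 m, m \in S & (0 < claimed S m)%N) ->
  (forall S : {set line G}, S != setT -> (0 < lvl S)%N ->
    (exists m, [/\ m \in S, (0 < claimed S m)%N & lvl (S :\ m) = lvl S]) \/
    ((#|unclaimed S| <= handout_level (lvl S))%N /\
     exists m, [/\ m \in S, claimed S m = 0%N & lvl (S :\ m) = 0%N])) ->
  @described G (fun S => if S == setT then [:: c] else [::])
    (fun S => if S == setT then 0%N else #|unclaimed S|)
    (fun S => if S == setT then 0%N else lvl S).
Proof.
move=> clong nonempty opn opb opl l2 lb lmono lpos take keep.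
have proper (S : {set line G}) m : m \in S -> (S :\ m == setT) = false.
  by move=> mS; apply/eqP => /setP/(_ m); rewrite !inE eqxx.
split.
- by move=> S; case: ifP => //=; rewrite clong.
- by move=> S; case: eqVneq => // ST; split => // /(lb _ ST).
- move=> S m mS; rewrite proper //; case: eqVneq => [->|ST].
    by left; exists c; rewrite opb opl opn addn0 maxn0; split.
  by right; split; [| exact: card_unclaimedD1 | exact: lmono | exact: lpos].
- move=> S d; case: eqVneq => // ->; rewrite inE => /eqP ->.
  case/card_gt0P: nonempty => m _; exists m => //.
  by rewrite proper // opb opl opn addn0 maxn0; split.
- move=> S; case: eqVneq => // ST; rewrite card_gt0 => /set0Pn[b]; rewrite inE.
  by case/set0Pn => l; rewrite inE => /andP[lS _]; apply: take => //; apply/set0Pn; exists l.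
move=> S; case: eqVneq => // ST l0; case: (keep S ST l0) => [[m [mS k e]]|[nS [m [mS k e]]]].
  by left; exists m; rewrite proper //; split.
right; split; first by apply/eqP; rewrite eqn_leq nS lb.
by exists m; rewrite proper //; split.
Qed.

Section Claims.
Context (G : game).
Implicit Types (S : {set line G}) (b : box G).

Lemma claimed_gt0 S b x y : lines_at setT b = [set x; y] ->
  x \in S -> y \notin S -> (0 < claimed S x)%N.
Proof.
move=> /setP e xS yS; rewrite /claimed card_gt0; apply/set0Pn; exists b; rewrite inE.
apply/eqP/setP => l; have := e l; rewrite !inE => /= ->.
have [->|_] := eqVneq l x; first by rewrite xS.
by case: eqVneq => [->|]; rewrite ?andbF // (negPf yS).
Qed.

Lemma claimed_eq0 S m : (forall b, b \in border m ->
    exists2 l, l != m & (l \in S) && (b \in border l)) ->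
  claimed S m = 0%N.
Proof.
move=> h; apply/eqP; rewrite cards_eq0 -subset0; apply/subsetP => b; rewrite !inE.
move=> /eqP/setP e; have := e m; rewrite !inE eqxx => /andP[_ /h[l lm]].
by have := e l; rewrite !inE (negPf lm) => ->.
Qed.

End Claims.

Lemma neq_setT (T : finType) (S : {set T}) : S != setT -> exists x, x \notin S.
Proof. by rewrite -subTset => /subsetPn[x _ xS]; exists x. Qed.

(** A discrete intermediate value argument: it yields a drawn and an undrawn line side by side,
    whose common box can then be captured. *)
Lemma exists_switch (p : nat -> bool) lo hi j k :
  (lo <= j <= hi)%N -> (lo <= k <= hi)%N -> p j -> ~~ p k ->
  exists i, (lo <= i)%N /\ (i < hi)%N /\ (p i != p i.+1).
Proof.
wlog jk : p j k / (j < k)%N.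
  move=> W hj hk pj pk; have [jk|kj|e] := ltngtP j k; first exact: (W p j k).
    have [|i [h1 [h2 h3]]] := W (fun i => ~~ p i) k j kj hk hj pk; first by rewrite negbK.
    by exists i; split=> //; split=> //; move: h3; case: (p i); case: (p i.+1).
  by rewrite e (negPf pk) in pj.
move=> /andP[lj _] /andP[_ kh] pj pk.
have : exists i, (j <= i)%N && ~~ p i by exists k; rewrite pk ltnW.
move=> ex; have [i /andP[ji pi] imin] := ex_minnP ex.
have ji' : (j < i)%N by rewrite ltn_neqAle ji andbT; apply: contraNneq pi => <-.
exists i.-1; rewrite prednK; last by lia.
split; first by lia.
split; first by have := imin k; rewrite pk ltnW //=; lia.
have : ~~ ((j <= i.-1)%N && ~~ p i.-1) by apply/negP => /imin; lia.
by rewrite (negPf pi) -ltnS prednK ?ji' /= ?negbK; [move=> -> | lia].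
Qed.

(** * Chains *)

Section Chain.
Variable n : nat.
Implicit Types S T : {set line (chain n.+3)}.
Let L (i : nat) : line (chain n.+3) := inord i.
Let B (i : nat) : box (chain n.+3) := inord i.

(* Meaningful only once a line is drawn: a maximal run of [r] undrawn lines then
   joins [r] boxes if it contains an end of the chain, and [r.+1] boxes otherwise. *)
Definition chain_level S : nat :=
  (if (L 0 \in S) && (L 1 \in S) || (L n.+2 \in S) && (L n.+3 \in S) then 2
  else [exists i : 'I_n.+2, [&& L i \in S, L i.+1 \in S & L i.+2 \in S]])%N.

Let L_ex (x : line (chain n.+3)) : exists2 i, (i <= n.+3)%N & x = L i.
Proof. by exists x; [exact: (ltn_ord x) | rewrite /L inord_val]. Qed.

Let B_ex (x : box (chain n.+3)) : exists2 i, (i <= n.+2)%N & x = B i.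
Proof. by exists x; [exact: (ltn_ord x) | rewrite /B inord_val]. Qed.

Let L_eq i j : (i <= n.+3)%N -> (j <= n.+3)%N -> (L i == L j) = (i == j).
Proof. by move=> hi hj; rewrite -val_eqE /= !inordK. Qed.

Let B_eq i j : (i <= n.+2)%N -> (j <= n.+2)%N -> (B i == B j) = (i == j).
Proof. by move=> hi hj; rewrite -val_eqE /= !inordK. Qed.

Let border_L i j : (i <= n.+3)%N -> (j <= n.+2)%N ->
  (B j \in border (L i)) = (i == j) || (i == j.+1).
Proof. by move=> hi hj; rewrite inE /= !inordK. Qed.

Let lines_B i : (i <= n.+2)%N -> lines_at setT (B i) = [set L i; L i.+1].
Proof.
move=> hi; apply/setP => x; have [j hj ->] := L_ex x.
by rewrite [LHS]inE in_setT border_L // !inE !L_eq //; lia.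
Qed.

Let unclaimed_B S i : (i <= n.+2)%N ->
  (B i \in unclaimed S) = (L i \in S) || (L i.+1 \in S).
Proof.
move=> hi; rewrite inE; apply/set0Pn/orP => [[l]|[] h].
- rewrite inE => /andP[lS lb]; have : l \in lines_at setT (B i) by rewrite inE inE.
  by rewrite lines_B // !inE => /orP[]/eqP <-; [left|right].
- by exists (L i); rewrite inE h border_L ?eqxx //; lia.
by exists (L i.+1); rewrite inE h border_L ?eqxx ?orbT //; lia.
Qed.

(** The bounds [lo] and [hi] confine the captured line, so that it can be kept away from the lines
    of a hand-out to be preserved. *)
Let chain_take S lo hi j k : (hi <= n.+3)%N ->
  (lo <= j <= hi)%N -> (lo <= k <= hi)%N -> L j \in S -> L k \notin S ->
  exists i, [/\ (lo <= i <= hi)%N, L i \in S & (0 < claimed S (L i))%N].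
Proof.
move=> hn hj hk jS kS.
have [i [h1 [h2]]] := @exists_switch (fun i => L i \in S) lo hi j k hj hk jS kS.
have bi := @lines_B i; case iS : (L i \in S); case iS' : (L i.+1 \in S) => // _.
  exists i; split=> //; first by lia.
  by apply: (@claimed_gt0 _ S (B i) (L i) (L i.+1)) => //; rewrite ?iS' ?bi //; lia.
exists i.+1; split=> //; first by lia.
by apply: (@claimed_gt0 _ S (B i) (L i.+1) (L i)); rewrite ?iS ?bi 1?setUC //; lia.
Qed.

Let three_mem S i : (i <= n.+1)%N -> L i \in S -> L i.+1 \in S -> L i.+2 \in S ->
  [exists i : 'I_n.+2, [&& L i \in S, L i.+1 \in S & L i.+2 \in S]].
Proof.
by move=> hi a b c; apply/existsP; exists (inord i); rewrite inordK // a b c.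
Qed.

Let notin_three i j : (j < i)%N || (i.+2 < j)%N -> (i <= n.+1)%N -> (j <= n.+3)%N ->
  L j \notin [set L i; L i.+1; L i.+2].
Proof. by move=> h hi hj; rewrite !inE !L_eq //; lia. Qed.

Let chain_level_mono S T : S \subset T -> (chain_level S <= chain_level T)%N.
Proof.
move=> /subsetP ST; rewrite /chain_level; case: ifP => [|_].
  by move=> /orP[]/andP[/ST -> /ST ->]; rewrite ?orbT.
case: ifP => _; first by rewrite (leq_trans (leq_b1 _)).
by case: existsP => // -[i /and3P[/ST a /ST b /ST c]]; rewrite (@three_mem T i) // -ltnS.
Qed.

Let claimed_adj S i : (i <= n.+3)%N -> L i \in S -> claimed S (L i) = 0%N ->
  ((0 < i)%N -> L i.-1 \in S) /\ ((i <= n.+2)%N -> L i.+1 \in S).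
Proof.
move=> hi iS k; split=> h; apply/negPn/negP => jS.
  suff : (0 < claimed S (L i))%N by rewrite k.
  apply: (@claimed_gt0 _ S (B i.-1) (L i) (L i.-1)) => //.
  by rewrite lines_B 1?setUC ?prednK //; lia.
suff : (0 < claimed S (L i))%N by rewrite k.
apply: (@claimed_gt0 _ S (B i) (L i) (L i.+1)) => //.
by rewrite lines_B.
Qed.

Let claimed0 S i : (i <= n.+3)%N -> ((0 < i)%N -> L i.-1 \in S) ->
  ((i <= n.+2)%N -> L i.+1 \in S) -> claimed S (L i) = 0%N.
Proof.
move=> hi h1 h2; apply: claimed_eq0 => b; have [j hj ->] := B_ex b.
rewrite border_L // => /orP[]/eqP e.
  exists (L i.+1); first by rewrite L_eq //; lia.
  by rewrite h2 ?border_L ?e ?eqxx ?orbT //; lia.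
exists (L i.-1); first by rewrite L_eq //; lia.
by rewrite h1 ?border_L ?e ?eqxx ?orbT //; lia.
Qed.

Let card_ge S (s : seq nat) : uniq s -> all (fun i => (i <= n.+2)%N && (B i \in unclaimed S)) s ->
  (size s <= #|unclaimed S|)%N.
Proof.
move=> us /allP hs; rewrite cardE -(size_map B); apply: uniq_leq_size.
  rewrite map_inj_in_uniq // => i j /hs/andP[hi _] /hs/andP[hj _] /eqP.
  by rewrite B_eq // => /eqP.
by move=> b /mapP[i /hs/andP[_ h] ->]; rewrite mem_enum.
Qed.

Let card_le S (s : seq nat) : (forall i, (i <= n.+2)%N -> B i \in unclaimed S -> i \in s) ->
  (#|unclaimed S| <= size s)%N.
Proof.
move=> h; rewrite cardE -(size_map B); apply: uniq_leq_size; first exact: enum_uniq.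
move=> b; rewrite mem_enum; have [j hj ->] := B_ex b => bu.
by apply: map_f; apply: h.
Qed.

(** The delicate condition is the last one: the lines realising the level are left alone while a
    capture elsewhere exists; when there is none, only the boxes of the hand-out remain, and one
    move offers them. *)
Lemma described_chain : exists hs nb lv,
  @described (chain n.+3) hs nb lv /\
  (hs setT = [:: (false, n.+3)] /\ nb setT = 0%N /\ lv setT = 0%N).
Proof.
exists (fun S => if S == setT then [:: (false, n.+3)] else [::]).
exists (fun S => if S == setT then 0%N else #|unclaimed S|).
exists (fun S => if S == setT then 0%N else chain_level S).
split; last by rewrite eqxx.
apply: (@described_unit (chain n.+3) (false, n.+3) chain_level) => //.
- by rewrite /= card_ord.
- move=> m; have [i hm ->] := L_ex m.
  by apply: claimed0; rewrite ?inE.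
- move=> m; rewrite /= -[RHS]card_ord -cardsT; apply: eq_card => b; rewrite [RHS]inE.
  have [j hb ->] := B_ex b; have [i hm ->] := L_ex m.
  by rewrite unclaimed_B // !inE !L_eq //; lia.
- move=> m; have [i hm ->] := L_ex m.
  rewrite /chain_level ifT // !inE !L_eq //; lia.
- by move=> S; rewrite /chain_level; case: ifP => // _; rewrite (leq_trans (leq_b1 _)).
- move=> S ST; rewrite /chain_level; case: ifP => [ends _|noends].
    case/orP: ends => /andP[a b].
      by apply: (@card_ge S [:: 0; 1]%N); rewrite //= !unclaimed_B ?a ?b //=; lia.
    apply: (@card_ge S [:: n.+1; n.+2]%N); first by rewrite /= !inE; lia.
    by rewrite /= !unclaimed_B ?a ?b ?orbT //; lia.
  case: existsP => // -[i /and3P[a b c]] _ /=; have hi := ltn_ord i.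
  (* Since neither end has two undrawn lines, the three lines avoid both ends and touch the four
     boxes [B i.-1] to [B i.+2]. *)
  have i0 : (0 < i)%N.
    by rewrite lt0n; apply/eqP => e; rewrite e in a b; rewrite a b in noends.
  have i1 : (i <= n)%N.
    rewrite -ltnS ltn_neqAle -ltnS hi andbT; apply/eqP => e; rewrite e in b c.
    by rewrite b c orbT in noends.
  apply: (@card_ge S [:: i.-1; i : nat; i.+1; i.+2]).
    by rewrite /= !inE; clear -i0; lia.
  by rewrite /= !unclaimed_B ?prednK ?a ?b ?c ?orbT //; clear -i0 i1; lia.
- by move=> S m _ _; apply/chain_level_mono/subD1set.
(* A line drawn without capture has all its neighbours undrawn: it is the middle of three undrawn
   lines, or an end line with its neighbour. *)
- move=> S x ST; have [m hm ->] := L_ex x => mS k.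
  have [h1 h2] := claimed_adj _ _ hm mS k; rewrite /chain_level.
  case: ifP => // /negbT; rewrite negb_or !negb_and => /andP[e1 e2].
  have m0 : (0 < m)%N.
    by rewrite lt0n; apply/eqP => e; rewrite e in mS h2; rewrite mS h2 in e1.
  have m1 : (m <= n.+2)%N.
    rewrite -ltnS ltn_neqAle hm andbT; apply/eqP => e; have := h1 m0.
    by rewrite e /= in mS *; move=> h; rewrite mS h in e2.
  by rewrite (@three_mem S m.-1) ?prednK ?h1 ?h2 //; lia.
- move=> S ST /set0Pn[j jS]; have [k kS] := neq_setT _ _ ST.
  have [j' hj E] := L_ex j; have [k' hk E'] := L_ex k.
  rewrite {}E in jS; rewrite {}E' in kS.
  have [//|//|//|i [_ iS ci]] := @chain_take S 0 n.+3 j' k' _ _ _ jS kS.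
  by exists (L i).
move=> S ST; have [k kn kS] : exists2 k, (k <= n.+3)%N & L k \notin S.
  have [k kS] := neq_setT _ _ ST.
  by have [i hi E] := L_ex k; exists i; rewrite -?E.
(* [T] will consist of undrawn lines that realise the level; monotonicity squeezes the level after
   the capture between those of [T] and [S]. *)
have keep T i : T \subset S -> L i \notin T -> L i \in S -> (0 < claimed S (L i))%N ->
    chain_level T = chain_level S ->
    exists m, [/\ m \in S, (0 < claimed S m)%N & chain_level (S :\ m) = chain_level S].
  move=> TS iT iS ci e; exists (L i); split=> //; apply/eqP; rewrite eqn_leq.
  rewrite chain_level_mono ?subD1set // -e chain_level_mono //.
  by rewrite subsetD1 TS.
have level2 T : (L 0 \in T) && (L 1 \in T) || (L n.+2 \in T) && (L n.+3 \in T) ->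
    chain_level T = 2%N by rewrite /chain_level => ->.
case E : ((L 0 \in S) && (L 1 \in S) || (L n.+2 \in S) && (L n.+3 \in S)).
  move=> _; rewrite (level2 S E).
  case/orP: E => /andP[a b].
    have k2 : (2 <= k)%N by case: k kS {kn} => [|[|]]; rewrite ?a ?b.
    (* Left end: an undrawn line from [L 2] on, together with the drawn [L k], gives a capture away
       from [L 0] and [L 1]. Otherwise drawing [L 0] offers two boxes, both completed by [L 1]. *)
    case: (boolP [exists j : 'I_n.+4, (2 <= j)%N && (L j \in S)]).
      case/existsP => j /andP[j2 jS]; have hj := ltn_ord j; left.
      have [//|||i [hi iS ci]] := @chain_take S 2 n.+3 j k _ _ _ jS kS; [by lia| by lia|].
      rewrite -(level2 S) ?a ?b //; apply: (@keep [set L 0; L 1] i) => //.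
      - by apply/subsetP => x; rewrite !inE => /orP[]/eqP ->.
      - by rewrite !inE !L_eq //; lia.
      by rewrite !level2 // ?a ?b // !inE !eqxx ?orbT.
    rewrite negb_exists => /forallP h; right.
    have S2 j : (2 <= j <= n.+3)%N -> (L j \in S) = false.
      move=> /andP[j2 jn]; have := h (inord j); rewrite inordK // j2 /= => /negPf.
      by rewrite -[L j]/(L j).
    split.
      apply: (@card_le S [:: 0; 1]%N) => -[|[|i]] // hi.
      by rewrite unclaimed_B // !S2 //; lia.
    exists (L 0); split=> //; first exact: claimed0.
    have e1 j : (2 <= j <= n.+3)%N -> (L j \in S :\ L 0) = false.
      by move=> hj; rewrite inE S2 ?andbF.
    rewrite /chain_level setD11 (e1 n.+3) //= andbF.
    by case: existsP => // -[i]; rewrite (e1 i.+2) ?andbF //; have := ltn_ord i; lia.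
  (* The mirror case at the right end, where the offering move is [L n.+3]. *)
  have k2 : (k <= n.+1)%N.
    have [e|k3] := eqVneq k n.+3; first by rewrite e b in kS.
    have [e|k2] := eqVneq k n.+2; first by rewrite e a in kS.
    by lia.
  case: (boolP [exists j : 'I_n.+4, (j <= n.+1)%N && (L j \in S)]).
    case/existsP => j /andP[j2 jS]; have hj := ltn_ord j; left.
    have [|||i [hi iS ci]] := @chain_take S 0 n.+1 j k _ _ _ jS kS; [by lia| by lia|by lia|].
    rewrite -(level2 S) ?a ?b ?orbT //; apply: (@keep [set L n.+2; L n.+3] i) => //.
    - by apply/subsetP => x; rewrite !inE => /orP[]/eqP ->.
    - by rewrite !inE !L_eq //; lia.
    by rewrite !level2 // ?a ?b ?orbT // !inE !eqxx ?orbT.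
  rewrite negb_exists => /forallP h; right.
  have S2 j : (j <= n.+1)%N -> (L j \in S) = false.
    by move=> j2; have := h (inord j); rewrite inordK ?j2 //=; [move/negPf | lia].
  split.
    apply: (@card_le S [:: n.+1; n.+2]%N) => i hi.
    rewrite unclaimed_B // !inE => hS; apply/negPn/negP => hi'.
    by move: hS; rewrite !S2 //; lia.
  exists (L n.+3); split=> //; first by apply: claimed0 => //; lia.
  have e1 j : (j <= n.+1)%N -> (L j \in S :\ L n.+3) = false.
    by move=> hj; rewrite inE S2 ?andbF.
  rewrite /chain_level setD11 (e1 0%N) //= andbF.
  by case: existsP => // -[i]; rewrite (e1 i) // -ltnS.
move=> l0; have [i0 h0] : exists i : 'I_n.+2, [&& L i \in S, L i.+1 \in S & L i.+2 \in S].
  by move: l0; rewrite /chain_level E; case: existsP.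
(* Level 1: the leftmost triple of undrawn lines is chosen, so that [L i.-1] is drawn and any
   undrawn line to its left leads to a capture there. *)
have : exists i, (i <= n.+1)%N && [&& L i \in S, L i.+1 \in S & L i.+2 \in S].
  by exists i0; rewrite h0 -ltnS ltn_ord.
move=> ex; have [i /andP[hi /and3P[a b c]] imin] := ex_minnP ex.
case/norP: (negbT E); rewrite !negb_and => e1 e2.
have i0' : (0 < i)%N by rewrite lt0n; apply/eqP => e; rewrite e in a b; rewrite a b in e1.
have i1' : (i <= n)%N.
  rewrite -ltnS ltn_neqAle hi andbT; apply/eqP => e; rewrite e in b c.
  by rewrite b c in e2.
have three T : T \subset S -> L i \in T -> L i.+1 \in T -> L i.+2 \in T -> chain_level T = 1%N.
  move=> TS a' b' c'; apply/eqP; rewrite eqn_leq; apply/andP; split.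
    by apply: leq_trans (chain_level_mono _ _ TS) _; by rewrite /chain_level E leq_b1.
  by rewrite /chain_level; case: ifP => //; rewrite (@three_mem T i).
have S1 : chain_level S = 1%N by apply: three.
rewrite S1.
have keep3 j : L j \in S -> (j <= n.+3)%N -> (j < i)%N || (i.+2 < j)%N -> (0 < claimed S (L j))%N ->
    exists m, [/\ m \in S, (0 < claimed S m)%N & chain_level (S :\ m) = 1%N].
  move=> jS jn ji cj; have := @keep [set L i; L i.+1; L i.+2] j; rewrite S1; apply=> //.
  - by apply/subsetP => x; rewrite !inE => /orP[/orP[]|]/eqP ->.
  - exact: notin_three.
  rewrite three // ?inE ?eqxx ?orbT //.
  by apply/subsetP => x; rewrite !inE => /orP[/orP[]|]/eqP ->.
case: (boolP [exists j : 'I_n.+4, (j < i)%N && (L j \in S)]).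
  case/existsP => j /andP[ji jS]; left.
  have i1S : L i.-1 \notin S.
    apply/negP => h; suff /imin : (i.-1 <= n.+1)%N &&
      [&& L i.-1 \in S, L i.-1.+1 \in S & L i.-1.+2 \in S] by clear -i0'; lia.
    by rewrite prednK // h a b (leq_trans (leq_pred i) hi).
  have [|||l [hl lS cl]] := @chain_take S 0 i.-1 j i.-1 _ _ _ jS i1S;
    [clear -hi; lia|clear -ji i0'; lia|clear; lia|].
  apply: (keep3 l) => //; clear -hl hi i0'; lia.
rewrite negb_exists => /forallP low.
have lowS j : (j < i)%N -> (L j \in S) = false.
  by move=> ji; have := low (inord j); rewrite inordK ?ji //=; [move/negPf | clear -ji hi; lia].
case: (boolP [exists j : 'I_n.+4, (i.+2 < j)%N && (L j \in S)]).
  case/existsP => j /andP[ji jS]; have hj := ltn_ord j; left.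
  (* Level 2 being excluded, one of the last two lines is drawn, and it lies beyond the triple. *)
  have [l hl lS] : exists2 l, (i.+2 < l <= n.+3)%N & L l \notin S.
    case/orP: e2 => h; [exists n.+2 | exists n.+3] => //; last by clear -i1'; lia.
    suff : i.+2 != n.+2 by clear -i1'; lia.
    by apply/eqP => e; rewrite e in c; rewrite c in h.
  have [|||l' [hl' lS' cl]] := @chain_take S i.+3 n.+3 j l _ _ _ jS lS;
    [by []|clear -ji hj; lia|clear -hl; lia|].
  apply: (keep3 l') => //; clear -hl'; lia.
rewrite negb_exists => /forallP high.
have highS j : (i.+2 < j <= n.+3)%N -> (L j \in S) = false.
  by move=> /andP[ji jn]; have := high (inord j); rewrite inordK ?ji //= => /negPf.
right; split.
  apply: (@card_le S [:: i.-1; i; i.+1; i.+2]%N) => j hj.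
  rewrite unclaimed_B // !inE => hS; apply/negPn/negP => hj'.
  have [ji|ji] := ltnP j i; first by move: hS; rewrite !lowS //; clear -ji hj'; lia.
  by move: hS; rewrite !highS //; clear -ji hj hj'; lia.
(* Only four boxes remain; drawing the middle line splits them into two pairs, each completed by a
   single line. *)
exists (L i.+1); split=> //; first by apply: claimed0 => //; clear -i1'; lia.
have eS j : (j <= n.+3)%N -> L j \in S :\ L i.+1 -> (j == i) || (j == i.+2).
  move=> hj; rewrite !inE L_eq //; last by clear -i1'; lia.
  have [ji|ji] := ltnP j i; first by rewrite lowS // andbF.
  by have [ji'|ji'] := ltnP i.+2 j; [rewrite highS ?ji' // andbF | clear -ji ji'; lia].
rewrite /chain_level ifN.
  case: existsP => // -[j /and3P[/eS j1 /eS j2 _]]; have := ltn_ord j; clear -j1 j2; lia.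
by apply/norP; split; apply/andP => -[/eS j1 /eS j2]; clear -j1 j2 i0' i1'; lia.
Qed.

End Chain.

(** * Loops *)

Section Loop.
Variable n : nat.
Implicit Types (S T : {set line (loop n.+4)}) (x y : 'I_n.+4).
(** Positions are counted from an arbitrary origin [x], so that a given triple of lines can be put
    at 0, 1, 2. *)
Let R x (k : nat) : 'I_n.+4 := iter k (@ordS n.+4) x.

(** A loop has no end line, so level 2 does not occur; once a line is drawn, three consecutive
    undrawn lines join four boxes. *)
Definition loop_level S : nat :=
  [exists x : 'I_n.+4, [&& x \in S, ordS x \in S & ordS (ordS x) \in S]].

Let val_R x k : R x k = ((x + k) %% n.+4)%N :> nat.
Proof.
elim: k => [|k IH]; first by rewrite addn0 modn_small.
by rewrite [R x k.+1]/(ordS (R x k)) /= IH -addn1 modnDml addn1 addnS.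
Qed.

Let R_eq x i j : (i < n.+4)%N -> (j < n.+4)%N -> (R x i == R x j) = (i == j).
Proof. by move=> hi hj; rewrite -val_eqE /= !val_R eqn_modDl !modn_small. Qed.

Let R_ex x y : exists2 k, (k < n.+4)%N & y = R x k.
Proof.
exists ((y + (n.+4 - x)) %% n.+4)%N; first exact: ltn_pmod.
apply: val_inj; rewrite /= val_R modnDmr addnCA subnKC; last exact: ltnW.
by rewrite modnDr modn_small.
Qed.

Let ordS_neq x : (ordS x == x) = false.
Proof. exact: (R_eq x 1 0). Qed.

Let border_loop x y : (y \in border (x : line (loop n.+4))) = (x == y) || (ordS x == y).
Proof. by rewrite !inE ![y == _]eq_sym. Qed.

Let lines_loop x : lines_at setT (ordS x : box (loop n.+4)) = [set x; ordS x].
Proof.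
apply/setP => y; rewrite [LHS]inE in_setT border_loop !inE orbC.
by rewrite (inj_eq (can_inj (@ordSK _))).
Qed.

Let unclaimed_loop S x : ((ordS x : box (loop n.+4)) \in unclaimed S) = (x \in S) || (ordS x \in S).
Proof.
rewrite inE; apply/set0Pn/orP => [[l]|[] h].
- rewrite inE => /andP[lS lb]; have : l \in lines_at setT (ordS x : box (loop n.+4)).
    by rewrite inE inE.
  by rewrite lines_loop // !inE => /orP[]/eqP <-; [left|right].
- by exists x; rewrite inE h border_loop eqxx orbT.
by exists (ordS x); rewrite inE h border_loop eqxx.
Qed.

Let claimed0 S x : x \in S -> ordS (ordS x) \in S ->
  claimed S (ordS x : line (loop n.+4)) = 0%N.
Proof.
move=> a b; apply: claimed_eq0 => y; rewrite border_loop => /orP[]/eqP <-.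
  by exists x; rewrite 1?eq_sym ?ordS_neq // a border_loop eqxx orbT.
by exists (ordS (ordS x)); rewrite ?ordS_neq // b border_loop eqxx.
Qed.

Let claimed_adj S x : ordS x \in S -> claimed S (ordS x : line (loop n.+4)) = 0%N ->
  x \in S /\ ordS (ordS x) \in S.
Proof.
move=> xS k; split; apply/negPn/negP => yS;
  suff : (0 < claimed S (ordS x : line (loop n.+4)))%N by rewrite k.
  by apply: (@claimed_gt0 _ S (ordS x : box (loop n.+4)) _ x) => //; rewrite setUC lines_loop.
by apply: (@claimed_gt0 _ S (ordS (ordS x) : box (loop n.+4)) _ (ordS (ordS x))) => //; rewrite lines_loop.
Qed.

Let loop_take S x lo hi j k :
  (lo <= j <= hi)%N -> (lo <= k <= hi)%N -> R x j \in S -> R x k \notin S ->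
  exists i, [/\ (lo <= i <= hi)%N, R x i \in S & (0 < claimed S (R x i : line (loop n.+4)))%N].
Proof.
move=> hj hk jS kS.
have [i [h1 [h2]]] := @exists_switch (fun i => R x i \in S) lo hi j k hj hk jS kS.
have b := lines_loop (R x i).
case iS : (R x i \in S); case iS' : (R x i.+1 \in S) => // _.
  exists i; split=> //; first by lia.
  by apply: (@claimed_gt0 _ S (R x i.+1 : box (loop n.+4)) _ (R x i.+1)) => //; rewrite ?iS'.
exists i.+1; split=> //; first by lia.
by apply: (@claimed_gt0 _ S (R x i.+1 : box (loop n.+4)) _ (R x i)); rewrite ?iS // setUC.
Qed.

Let loop_level1 S x : x \in S -> ordS x \in S -> ordS (ordS x) \in S -> loop_level S = 1%N.
Proof.
by move=> a b c; rewrite /loop_level; case: existsP => // -[]; exists x; rewrite a b c.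
Qed.

Let loop_level_gt0 S : (0 < loop_level S)%N ->
  exists x, [&& x \in S, ordS x \in S & ordS (ordS x) \in S].
Proof. by rewrite /loop_level; case: existsP. Qed.

Let loop_level_mono S T : S \subset T -> (loop_level S <= loop_level T)%N.
Proof.
move=> /subsetP ST; have [->//|/loop_level_gt0[x]] := posnP (loop_level S).
by move=> /and3P[/ST a /ST b /ST c]; rewrite (loop_level1 T x) // leq_b1.
Qed.

(** Unlike in a chain, the lines outside a triple form a single arc, positions 3 to [n.+3], which
    contains a drawn line. Hence any triple will do, and a capture outside it exists as soon as the
    arc has an undrawn line. *)
Lemma described_loop : exists hs nb lv,
  @described (loop n.+4) hs nb lv /\
  (hs setT = [:: (true, n.+4)] /\ nb setT = 0%N /\ lv setT = 0%N).
Proof.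
exists (fun S => if S == setT then [:: (true, n.+4)] else [::]).
exists (fun S => if S == setT then 0%N else #|unclaimed S|).
exists (fun S => if S == setT then 0%N else loop_level S).
split; last by rewrite eqxx.
apply: (@described_unit (loop n.+4) (true, n.+4) loop_level) => //.
- by rewrite /= card_ord.
- by move=> m; rewrite -(@ord_predK _ m); apply: claimed0; rewrite inE.
- move=> m; rewrite /= -[RHS]card_ord -cardsT; apply: eq_card => b; rewrite [RHS]inE.
  rewrite -(@ord_predK _ b) unclaimed_loop !inE !andbT -negb_and.
  by apply/negP => /andP[/eqP <- /eqP e]; have := ordS_neq (ord_pred b); rewrite e eqxx.
- move=> m; apply: (loop_level1 _ (R m 1)); rewrite !inE andbT.
  + by rewrite -[X in _ != X]/(R m 0) R_eq.
  + by rewrite -[X in X != _]/(R m 2) -[X in _ != X]/(R m 0) R_eq.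
  by rewrite -[X in X != _]/(R m 3) -[X in _ != X]/(R m 0) R_eq.
- by move=> S; rewrite (leq_trans (leq_b1 _)).
- move=> S _ l0; have [x /and3P[a b c]] := loop_level_gt0 S l0.
  rewrite (loop_level1 S x) //= cardE.
  apply: (@uniq_leq_size _ [:: R x 0; R x 1; R x 2; R x 3]).
    by rewrite !cons_uniq !inE !R_eq.
  move=> y; rewrite mem_enum !in_cons in_nil orbF => /or4P[]/eqP ->.
  + by rewrite -[R x 0]ord_predK unclaimed_loop ord_predK a orbT.
  + by rewrite unclaimed_loop a.
  + by rewrite unclaimed_loop b.
  by rewrite unclaimed_loop c.
- by move=> S m _ _; apply/loop_level_mono/subD1set.
- move=> S m _; rewrite -(@ord_predK _ m) => mS /(claimed_adj _ _ mS)[a c].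
  by rewrite (loop_level1 _ _ a mS c).
- move=> S ST /set0Pn[x xS]; have [y yS] := neq_setT _ _ ST.
  have [k hk E] := R_ex x y; rewrite E in yS.
  have [//|//|i [_ iS ci]] := @loop_take S x 0 k 0 k _ _ xS yS.
    by rewrite /= leqnn.
  by exists (R x i).
move=> S ST l0; have [x /and3P[a b c]] := loop_level_gt0 S l0.
have S1 := loop_level1 S x a b c; rewrite S1.
have [k /andP[k3 kn] kS] : exists2 k, (3 <= k < n.+4)%N & R x k \notin S.
  have [y yS] := neq_setT _ _ ST.
  have [k hk E] := R_ex x y; exists k; rewrite -?E //; rewrite hk andbT.
  by case: k E {hk} yS => [|[|[|]]] // ->; rewrite ?a ?b ?c.
case: (boolP [exists j : 'I_n.+4, (3 <= j)%N && (R x j \in S)]).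
  case/existsP => j /andP[j3 jS]; left; have hj := ltn_ord j.
  have [||i [hi iS ci]] := @loop_take S x 3 n.+3 j k _ _ jS kS; [by rewrite j3..|by rewrite k3|].
  have {hi} [i3 ni] : (3 <= i)%N /\ (i < n.+4)%N by apply/andP.
  exists (R x i); split=> //; apply: (loop_level1 _ x).
  - by rewrite !inE a -[X in X != _]/(R x 0) R_eq //; clear -i3; lia.
  - by rewrite !inE b -[X in X != _]/(R x 1) R_eq //; clear -i3; lia.
  by rewrite !inE c -[X in X != _]/(R x 2) R_eq //; clear -i3; lia.
rewrite negb_exists => /forallP h; right.
have S3 i : (3 <= i)%N -> (i < n.+4)%N -> (R x i \in S) = false.
  by move=> i3 ni; have := h (Ordinal ni); rewrite /= i3 /= => /negPf.
split.
  rewrite cardE; apply: (@uniq_leq_size _ _ [:: R x 0; R x 1; R x 2; R x 3]).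
    exact: enum_uniq.
  move=> y; rewrite mem_enum; have [[|i] hi ->] := R_ex x y; first by rewrite in_cons eqxx.
  rewrite unclaimed_loop -/(R x i) -[ordS (R x i)]/(R x i.+1) => hS.
  have i2 : (i <= 2)%N.
    by rewrite leqNgt; apply/negP => i3; move: hS; rewrite !S3 // ltnW.
  by case: i i2 {hi hS} => [|[|[|]]] // _; rewrite !inE eqxx ?orbT.
exists (ordS x); split=> //; first exact: claimed0.
apply/eqP; rewrite -leqn0 leqNgt; apply/negP => /loop_level_gt0[y].
have [i hi ->] := R_ex x y.
rewrite -[ordS (R x i)]/(R x i.+1) -[ordS x]/(R x 1) => /and3P[].
rewrite !inE R_eq // => /andP[i1 iS] /andP[i1' iS'] _.
have i2 : (i <= 2)%N.
  by rewrite leqNgt; apply/negP => i3; move: iS; rewrite S3.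
case: i i1 i1' iS iS' i2 {hi} => [|[|[|]]] // i1 i1' iS iS' _.
- by case/eqP: i1'.
by rewrite S3 in iS'.
Qed.

End Loop.

(** * The value of an endgame in terms of its components *)

Lemma described_component c : long c -> exists hs nb lv,
  @described (component_game c) hs nb lv /\
  (hs setT = [:: c] /\ nb setT = 0%N /\ lv setT = 0%N).
Proof.
case: c => -[] [|[|[|[|n]]]] //= _; rewrite /component_game /=.
- exact: described_loop.
- exact: (described_chain 0).
exact: (described_chain n.+1).
Qed.

Lemma described_components (s : seq component) : all long s -> exists hs nb lv,
  @described (foldr disjoint_union empty_game (map component_game s)) hs nb lv /\
  (hs setT = s /\ nb setT = 0%N /\ lv setT = 0%N).
Proof.
elim: s => [_|c s IH /= /andP[/described_component hc /IH hs]].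
  by do 3!eexists; split; first exact: described_empty.
have [hs1 [nb1 [lv1 [d1 [e1 [f1 g1]]]]]] := hc.
have [hs2 [nb2 [lv2 [d2 [e2 [f2 g2]]]]]] := hs.
do 3!eexists; split; first exact: described_union d1 d2.
have lT : lpart (component_game c) (foldr disjoint_union empty_game (map component_game s)) setT = setT.
  by apply/setP => l; rewrite !inE.
have rT : rpart (component_game c) (foldr disjoint_union empty_game (map component_game s)) setT = setT.
  by apply/setP => l; rewrite !inE.
by rewrite lT rT e1 e2 f1 f2 g1 g2.
Qed.

(** At the start nothing is touched, so [controlled] reduces to minus the value of the recursion. *)
Lemma value_components (s : seq component) : all long s ->
  v (foldr disjoint_union empty_game (map component_game s)) = loony s.
Proof.
move=> /described_components[hs [nb [lv [d [e [f g]]]]]].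
by rewrite /v (value_described _ _ _ _ d) e f g /controlled add0r opprK.
Qed.

Definition components (G : endgame) : seq component :=
  map (pair false) (chains G) ++ map (pair true) (loops G).

Lemma v_loony (G : endgame) : simple_loony G -> v G = loony (components G).
Proof.
case/andP => hc hl; rewrite -value_components.
  rewrite /components map_cat -!map_comp /game_of.
  by congr (v (foldr _ _ (_ ++ _))); apply: eq_map.
rewrite /components all_cat !all_map; apply/andP; split; first exact: hc.
by apply: sub_all hl => n /andP[].
Qed.

(** * Endgames without 4-loops *)

Definition excess (c : component) : int := c.2%:Z - (if c.1 then 8 else 4).
Definition is_loop (c : component) : bool := c.1.

(** Without 3-chains this is [cv]: the terminal bonus then depends only on emptiness and on the
    presence of a chain. *)
Definition control (s : seq component) : int :=
  \sum_(c <- s) excess c + (if nilp s then 0 else if all is_loop s then 8 else 4).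

Lemma perm_control s t : perm_eq s t -> control s = control t.
Proof.
move=> p; rewrite /control (perm_big t p) /nilp (perm_size p).
by rewrite (eq_all_r (perm_mem p)).
Qed.

(** The bonus changes, from 8 to 4, only when a chain joins loops alone. *)
Lemma control_cons c t : t != [::] ->
  control (c :: t) = control t + excess c \/
  (~~ c.1 /\ all is_loop t /\ control (c :: t) = control t + excess c - 4).
Proof.
rewrite /control big_cons /=; case: t => // d t _; rewrite -[c.1]/(is_loop c).
move: (\sum_(i <- _) _) => x; case: (is_loop c) => /=; first by left; lia.
by case: ifP; [right | left]; do ?split=> //; lia.
Qed.

Lemma control1 c : control [:: c] = c.2%:Z.
Proof. by rewrite /control big_seq1 /= /excess /is_loop andbT; case: (c.1); lia. Qed.

Lemma control_ge4 s : s != [::] -> all (fun c => 0 <= excess c) s -> 4 <= control s.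
Proof.
move=> s0 h; have : 0 <= \sum_(c <- s) excess c.
  by rewrite big_seq; apply: sumr_ge0 => c cs; apply: (allP h).
rewrite /control; move: (\sum_(i <- s) _) => x x0; case: s s0 {h} => // c s _ /=.
by case: ifP; lia.
Qed.

Definition capped (c : int) : int :=
  if 2 <= c then c else if (4 %| c)%Z then 4 else if (2 %| c)%Z then 2 else 3.

(** Residues are given by explicit quotients, in the linear form that [lia] handles. *)
Variant capped_spec (c : int) : int -> Prop :=
  | CappedId of 2 <= c : capped_spec c c
  | CappedMod0 q of c <= 1 & c = 4 * q : capped_spec c 4
  | CappedMod2 q of c <= 1 & c = 4 * q + 2 : capped_spec c 2
  | CappedOdd q of c <= 1 & c = 2 * q + 1 : capped_spec c 3.

Lemma cappedP c : capped_spec c (capped c).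
Proof.
rewrite /capped; case: ifP => h2; first exact: CappedId.
case: ifP => h4; first by apply: (@CappedMod0 _ (c %/ 4)%Z); lia.
case: ifP => h; first by apply: (@CappedMod2 _ (c %/ 4)%Z); lia.
by apply: (@CappedOdd _ (c %/ 2)%Z); lia.
Qed.

(** The bound [m] is 4 in general and 6 when 4-loops are excluded, loop lengths being even. *)
Definition loop_or_long_chain (m : nat) (c : component) : bool :=
  if c.1 then (m <= c.2)%N && ~~ odd c.2 else (4 <= c.2)%N.

(** The lower bound for the recursion: no opening falls below the claimed value. Even loop lengths
    preserve the parity of the controlled value. *)
Lemma open_value_capped c x y : loop_or_long_chain 6 c ->
  y = x + excess c \/ ~~ c.1 /\ y = x + excess c - 4 ->
  capped y <= open_value c (capped x).
Proof.
rewrite /loop_or_long_chain /open_value /excess /handout; case: c => [[] n] /=.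
  move=> /andP[n6 en] [e|[//]].
  have [k nk] : exists k, n = k.*2 by exists n./2; rewrite even_halfK.
  by case: (cappedP x) => [?|p ? ?|p ? ?|p ? ?]; case: (cappedP y) => [?|q ? ?|q ? ?|q ? ?]; lia.
by move=> n4 h; case: (cappedP x) => [?|p ? ?|p ? ?|p ? ?]; case: (cappedP y) => [?|q ? ?|q ? ?|q ? ?]; lia.
Qed.

Lemma capped_id c : 2 <= c -> capped c = c.
Proof. by rewrite /capped => ->. Qed.

Lemma open_value_ge4 c x : 0 <= excess c -> 4 <= x -> open_value c x = x + excess c.
Proof. by rewrite /open_value /excess /handout; case: (c.1) => /=; lia. Qed.

(** The upper bound needs one good opening: a 6-loop if there is one, otherwise any loop, otherwise
    any chain. Without 6-loops all excesses are nonnegative, so a nonempty remainder has controlled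
    value at least 4 and the opening just adds the excess. *)
Lemma loony_no_4loop s : all (loop_or_long_chain 6) s ->
  loony s = if nilp s then 0 else capped (control s).
Proof.
have [n] := ubnP (size s); elim: n => // n IH in s *; rewrite ltnS => sn hs.
have [->//|s0] := eqVneq s [::].
have -> : nilp s = false by case: s s0 {sn hs}.
have {}IH c t : perm_eq s (c :: t) ->
    [/\ loop_or_long_chain 6 c, all (loop_or_long_chain 6) t &
     loony t = if nilp t then 0 else capped (control t)].
  move=> p; have : all (loop_or_long_chain 6) (c :: t) by rewrite -(eq_all_r (perm_mem p)).
  case/andP => hc ht; split=> //; apply: IH => //; apply: leq_trans sn.
  by rewrite (perm_size p).
have [[c [t [p e]]] hmin] := loony_min s s0.
apply/eqP; rewrite eq_le; apply/andP; split; last first.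
  have [hc ht et] := IH c t p; rewrite e et (perm_control _ _ p).
  case: t {p e ht et} => [|d t].
    rewrite control1 /open_value /handout /capped; case: c hc => -[] m; rewrite /loop_or_long_chain /=;
      case: ifP; lia.
  by apply: open_value_capped => //; case: (@control_cons c (d :: t) isT) => [|[? []]]; [left | right].
have upper c' t' : perm_eq s (c' :: t') -> open_value c' (loony t') = capped (control (c' :: t')) ->
    loony s <= capped (control s).
  by move=> p' e'; rewrite (perm_control _ _ p') -e'; exact: hmin.
(* The last component is treated apart, because [loony [::]] is 0 whereas [capped 0] is 4. *)
have single c' : perm_eq s [:: c'] -> loony s <= capped (control s).
  move=> p'; have [hc' _ _] := IH _ _ p'; apply: (upper c' [::] p').
  rewrite -[loony [::]]/(0 : int) control1 /open_value /handout /capped.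
  move: hc'; case: c' {p'} => -[] m; rewrite /loop_or_long_chain /=;
      case: ifP; lia.
(* Opening a 6-loop gives [2 + |capped x - 4|], which equals [capped (x - 2)] for every [x]. *)
have [h6|h6] := boolP ((true, 6%N) \in s).
  have p' := perm_to_rem h6; move: (rem _ _) p' => t' p'.
  have [t0|t0] := eqVneq t' [::]; first by rewrite t0 in p'; exact: single p'.
  apply: (upper _ _ p'); have [_ _ ->] := IH _ _ p'.
  have -> : nilp t' = false by case: t' t0 {p'}.
  case: (@control_cons (true, 6%N) t' t0) => [->|[//]].
  rewrite /open_value /excess /handout /=; move: (control t') => x; clear.
  case: (cappedP x) => [?|q ? ?|q ? ?|q ? ?];
  case: (cappedP (_ + _)) => [?|r ? ?|r ? ?|r ? ?]; lia.
have excess_ge0 c' t' : perm_eq s (c' :: t') -> all (fun c => 0 <= excess c) (c' :: t').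
  move=> p'; apply/allP => d dt; have ds : d \in s by rewrite (perm_mem p').
  have := allP hs _ ds; have : d != (true, 6%N) by apply: contraNneq h6 => <-.
  by rewrite /excess /loop_or_long_chain; case: d {dt ds} => -[] m /=; rewrite ?xpair_eqE /=; lia.
have finish c' t' : perm_eq s (c' :: t') -> (c'.1 || ~~ has is_loop t') -> loony s <= capped (control s).
  move=> p' h; have [t0|t0] := eqVneq t' [::]; first by apply: (single c'); rewrite -t0.
  apply: (upper _ _ p'); have [hc' _ ->] := IH _ _ p'.
  have -> : nilp t' = false by case: t' t0 {p' h}.
  have /andP[x0 xt] := excess_ge0 _ _ p'; have c4 := control_ge4 _ t0 xt.
  (* The bonus does not change here: either a loop is added, or the remainder contains a chain. *)
  have -> : control (c' :: t') = control t' + excess c'.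
    case: (@control_cons c' t' t0) => // -[c1 [lt _]].
    move: h; rewrite (negPf c1) /=; case: t' t0 lt {p' xt c4} => //= d t' _ /andP[-> _] //.
  have c2 : 2 <= control t' := le_trans (isT : 2 <= 4 :> int) c4.
  rewrite capped_id // open_value_ge4 // capped_id //.
  by apply: le_trans c2 _; rewrite lerDl.
have [/hasP[c' cs c1]|hl] := boolP (has is_loop s).
  by apply: (finish c' (rem c' s)); [exact: perm_to_rem | rewrite -[c'.1]/(is_loop c') c1].
apply: (finish c t p); apply/orP; right; apply: contra hl.
by rewrite (eq_has_r (perm_mem p)) /= => ->; rewrite orbT.
Qed.

(** These estimates serve to compare opening [c] with opening a 4-loop first. They are stated as
    distances in order to survive any number of 1-Lipschitz maps. The second alternative suffices
    for chains thanks to their smaller hand-out. *)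
Lemma loony_remove s c t : all (loop_or_long_chain 6) s -> perm_eq s (c :: t) ->
  `|loony s - `|loony t - 4| | <= c.2%:Z - 4 \/
  ~~ c.1 /\ `| `|loony s - 4| - `|loony t - 4| | <= c.2%:Z - 4.
Proof.
move=> hs p; have : all (loop_or_long_chain 6) (c :: t) by rewrite -(eq_all_r (perm_mem p)).
case/andP => hc ht; rewrite (perm_loony _ _ p) !loony_no_4loop /= ?hc //.
have [t0|t0] := eqVneq t [::].
  rewrite t0 control1 /=; left; move: hc; rewrite /loop_or_long_chain.
  by case: c {p} => -[] n /= h; rewrite capped_id; lia.
have -> : nilp t = false by case: t t0 {p ht}.
have := @control_cons c t t0; move: (control t) (control (c :: t)) => x y.
rewrite /excess; move: hc; rewrite /loop_or_long_chain; case: c {p} => -[] n /= hc.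
  case=> [e|[//]]; left; have {hc} [n6 [k nk]] : (6 <= n)%N /\ exists k, n = k.*2.
    by case/andP: hc => n6 en; split=> //; exists n./2; rewrite even_halfK.
  by case: (cappedP x) => [?|p ? ?|p ? ?|p ? ?]; case: (cappedP y) => [?|q ? ?|q ? ?|q ? ?]; lia.
move=> h; have {}h : y = x + (n%:Z - 4) \/ y = x + (n%:Z - 8).
  by case: h => [|[_ [_]]] ->; [left | right]; lia.
by case: h => h; case: (cappedP x) => [?|p ? ?|p ? ?|p ? ?]; case: (cappedP y) => [?|q ? ?|q ? ?|q ? ?]; lia.
Qed.

(** * Adding 4-loops *)

Definition flip (x : int) : int := `|x - 4|.

Lemma iter_flip_lipschitz f x y : `|iter f flip x - iter f flip y| <= `|x - y|.
Proof. by elim: f => //= f; rewrite /flip; lia. Qed.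

Lemma loony_4loops s : all (loop_or_long_chain 4) s ->
  loony s = iter (count_mem (true, 4%N) s) flip (loony [seq c <- s | c != (true, 4%N)]).
Proof.
have [n] := ubnP (size s); elim: n => // n IH in s *; rewrite ltnS => sn hs.
have [h4|h4] := boolP ((true, 4%N) \in s); last first.
  by rewrite (count_memPn h4) /= (all_filterP _) //; apply/allP => c cs; apply: contraNneq h4 => <-.
have hK : all (loop_or_long_chain 6) [seq c <- s | c != (true, 4%N)].
  apply/allP => c; rewrite mem_filter => /andP[c4 /(allP hs)].
  by move: c4; rewrite /loop_or_long_chain; case: c => -[] m //=; rewrite xpair_eqE /=; lia.
have {}IH c t : perm_eq s (c :: t) ->
    [/\ loony t = iter (count_mem (true, 4%N) t) flip (loony [seq c <- t | c != (true, 4%N)]),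
        count_mem (true, 4%N) s = ((c == (true, 4%N)) + count_mem (true, 4%N) t)%N,
        perm_eq [seq c <- s | c != (true, 4%N)] [seq c <- c :: t | c != (true, 4%N)] &
        loop_or_long_chain 4 c].
  move=> p; have : all (loop_or_long_chain 4) (c :: t) by rewrite -(eq_all_r (perm_mem p)).
  case/andP => hc ht; split=> //; first by apply: IH => //; apply: leq_trans sn; rewrite (perm_size p).
    by rewrite (permP p).
  exact: perm_filter.
set K := [seq c <- s | _] in hK IH *.
have s0 : s != [::] by case: s h4 {sn hs K hK IH}.
have step t : perm_eq s ((true, 4%N) :: t) -> open_value (true, 4%N) (loony t) =
    iter (count_mem (true, 4%N) s) flip (loony K).
  move=> p; have [-> -> pK _] := IH _ _ p; rewrite /= in pK.
  by rewrite eqxx (perm_loony _ _ pK) /open_value /= subrr add0r.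
have [[c [t [p e]]] hmin] := loony_min s s0.
apply/eqP; rewrite eq_le; apply/andP; split.
  have p4 := perm_to_rem h4; rewrite -(step _ p4); exact: hmin.
have [c4|c4] := eqVneq c (true, 4%N).
  by rewrite c4 in p e; rewrite e (step _ p).
have [et es pK hc] := IH _ _ p; rewrite (negPf c4) add0n in es; rewrite /= c4 in pK.
rewrite e et -es; have := loony_remove _ _ _ hK pK.
have [f ef] : exists f, count_mem (true, 4%N) s = f.+1.
  by exists (count_mem (true, 4%N) s).-1; rewrite prednK // -has_count has_pred1.
rewrite ef; move: (loony K) (loony [seq d <- t | d != (true, 4%N)]) => z y.
(* Applying all [f.+1] flips to the first alternative of [loony_remove], and all but one to the
   second, shows that opening [c] is no better than opening a 4-loop. *)
have h1 := iter_flip_lipschitz f.+1 z (flip y).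
have h2 := iter_flip_lipschitz f (flip z) (flip y).
rewrite -!iterSr /= -/(flip (iter f flip _)) in h1 h2.
rewrite -[iter f.+1 flip y]/(flip (iter f flip y)) -[iter f.+1 flip z]/(flip (iter f flip z)).
move: h1 h2 hc; rewrite /open_value /handout /loop_or_long_chain.
move: (iter f flip z) (iter f flip y) => a b.
by rewrite /flip; case: c {p e c4 pK} => -[] m /=; clear; lia.
Qed.

(** Each 4-loop contributes -4, and removing them leaves the bonus alone unless nothing remains. *)
Lemma count_remove_4loops s : let K := [seq c <- s | c != (true, 4%N)] in
  control s = if nilp K then if nilp s then 0 else 8 - 4 * (count_mem (true, 4%N) s)%:Z
              else control K - 4 * (count_mem (true, 4%N) s)%:Z.
Proof.
move=> K; have E : \sum_(c <- s) excess c = \sum_(c <- K) excess c - 4 * (count_mem (true, 4%N) s)%:Z.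
  rewrite /K {K}; elim: s => [|c s IH]; first by rewrite !big_nil.
  by rewrite big_cons {}IH /=; case: eqVneq => [->|_] /=; rewrite ?big_cons /excess /=; lia.
have L : all is_loop K = all is_loop s.
  by rewrite /K {K E}; elim: s => //= c s IH; case: eqVneq => [->|_] /=; rewrite IH.
rewrite /control E L; case: (nilp K) / nilP => [K0|K0].
  have -> : all is_loop s by rewrite -L K0.
  by rewrite K0 big_nil; case: nilP => [->|_] /=; lia.
have -> : nilp s = false by apply/nilP => s0; apply: K0; rewrite /K s0.
by rewrite addrAC.
Qed.

(** * Iterated flips and the conclusion *)

Lemma iter_flip_ge f x : (4 * f)%N%:Z <= x -> iter f flip x = x - (4 * f)%N%:Z.
Proof. by elim: f => [|f IH] h /=; [lia | rewrite IH /flip; lia]. Qed.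

(** [4 - |4 - d|] is the distance from [x] to the nearest multiple of 8, and [flip] changes this
    distance [t] into [4 - t]. The upper bound on [x] ensures that [f] flips end between 0 and 4,
    where a number equals its distance. *)
Lemma iter_flip_mod8 f x d : 0 <= x -> x <= (4 * f + 4)%N%:Z ->
  0 <= d <= 7 -> (d = x %[mod 8])%Z ->
  iter f flip x = if odd f then `|4 - d| else 4 - `|4 - d|.
Proof.
elim: f x d => [|f IH] x d x0 xf d07 dx; first by move: xf dx; rewrite /=; lia.
rewrite iterSr (IH _ ((`|x - 4|)%R %% 8)%Z); rewrite /flip ?modz_mod //; try lia.
by rewrite /=; case: (odd f) => /=; lia.
Qed.

Theorem corollary22 (G : endgame) (hG : simple_loony G)
    (h3 : 3%N \notin chains G) :
  let f := count_mem 4%N (loops G) in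
  let c := cv G in
  let K := remove_4loops G in
  (2 <= c \/ is_empty G -> v G = c) /\
  (~~ is_empty G ->
    [/\ c <= 1 -> f = 0%N -> ~~ (2 %| c)%Z -> v G = 3,
        c <= 1 -> f = 0%N -> (2 %| c)%Z ->
          (v G = 2 \/ v G = 4) /\ (v G = c %[mod 4])%Z
      & c <= 1 -> (1 <= f)%N ->
          forall d : int, 0 <= d <= 7 -> (d = v K %[mod 8])%Z ->
            (odd f -> v G = `|4 - d|) /\ (~~ odd f -> v G = 4 - `|4 - d|)]).
Proof.
move=> f c K.
have hK : simple_loony K.
  by case/andP: hG => hc hl; rewrite /simple_loony hc; apply/allP => n;
    rewrite mem_filter => /andP[_ /(allP hl)].
have good : all (loop_or_long_chain 4) (components G).
  case/andP: hG => hc hl; rewrite all_cat !all_map hl andbT; apply/allP => n nc /=.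
  have := allP hc _ nc; rewrite /loop_or_long_chain /=.
  by have : n != 3%N by [apply: contraNneq h3 => <-]; lia.
have fE : count_mem (true, 4%N) (components G) = f.
  rewrite count_cat !count_map (eq_count (a2 := pred0)) // count_pred0 add0n.
  exact: eq_count.
have KE : components K = [seq c <- components G | c != (true, 4%N)].
  rewrite filter_cat !filter_map (eq_filter (a2 := predT)) // filter_predT.
  by congr (_ ++ map _ _); apply: eq_filter.
have emptyE : is_empty G = nilp (components G).
  by rewrite /is_empty /components; case: (chains G) => //=; case: (loops G).
(* 3-chains being excluded, the bonus 6 does not occur. *)
have cE : c = control (components G).
  rewrite /c /cv /fcv /control big_cat !big_map /tb emptyE; congr (_ + _).
  rewrite all_cat !all_map; case: ifP => //; rewrite -emptyE /is_empty.
  have : all (fun n => 4 <= n)%N (chains G).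
    by apply/allP => n nc; apply: (allP good (false, n)); rewrite mem_cat map_f.
  case: (chains G) => [_|n s /= /andP[-> _]] //=.
  by case: (nilp _) => //= _; rewrite (eq_all (a2 := predT)) // all_predT.
have all6 : all (loop_or_long_chain 6) (components K).
  apply/allP => x; rewrite KE mem_filter => /andP[x4 /(allP good)].
  by move: x4; rewrite /loop_or_long_chain; case: x => -[] m //=; rewrite xpair_eqE /=; lia.
have vK := loony_no_4loop _ all6.
have vG : v G = iter f flip (loony (components K)).
  by rewrite v_loony // loony_4loops // fE KE.
have := count_remove_4loops (components G); rewrite /= -KE -cE fE -emptyE.
rewrite (v_loony _ hK) {}vG {}vK.
have f0 : f = 0%N -> nilp (components K) -> is_empty G.
  move=> f0; rewrite KE emptyE => /nilP K0; rewrite -fE in f0.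
  by apply/nilP/eqP; rewrite -size_eq0 -(count_predC (pred1 (true, 4%N))) f0 -size_filter K0.
have f1 : is_empty G -> f = 0%N /\ nilp (components K).
  by rewrite emptyE -fE KE => /nilP ->.
move: f0 f1; case: (nilp (components K)).
  (* [K] is empty: [G] consists of 4-loops alone, with [c = 8 - 4 * f] when nonempty. So [2 <= c]
     forces [f = 1], and cases (b) and (c) cannot occur. *)
  move=> f0 f1 cf; split.
    case: ifP cf => [/f1[-> _] -> //|e ->] [|//] h.
    by have -> : f = 1%N by case: (f) f0 h => [/(_ erefl isT)|[|]] //; [rewrite e | lia].
  move=> e; rewrite (negPf e) in cf f0; split.
  - by move=> _ /f0 /(_ isT).
  - by move=> _ /f0 /(_ isT).
  move=> c1 f2 d d07 d0.
  by split=> h; rewrite (iter_flip_mod8 _ _ d) ?(negPf h) ?h //; lia.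
(* [K] is nonempty, with controlled value [C] and [c = C - 4 * f]. If [2 <= c], each flip subtracts
   4. *)
move: (control _) => C f0 f1 cC; split.
  case=> [h|/f1[_ //]]; have C2 : 2 <= C by lia.
  by rewrite capped_id // iter_flip_ge //; lia.
move=> e; split.
- by move=> c1 ff; rewrite ff in cC *; rewrite /=; case: (cappedP C) => [?|q ? ?|q ? ?|q ? ?]; lia.
- move=> c1 ff; rewrite ff in cC *; rewrite /=; case: (cappedP C) => [?|q ? ?|q ? ?|q ? ?];
    by [lia | split; [by [left|right] | lia]].
move=> c1 f2 d d07 dC.
(* From [c <= 1] follows [C <= 4 * f + 1], while [capped] is at most 4 where it differs from the
   identity. *)
have [x0 xf] : 0 <= capped C /\ capped C <= (4 * f + 4)%N%:Z.
  by case: (cappedP C) => [?|q ? ?|q ? ?|q ? ?]; lia.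
by split=> h; rewrite (iter_flip_mod8 _ _ d) ?(negPf h) ?h.
Qed.
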